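(* Let $p>1$ and let $\varphi$ be an analytic self-map of $\mathbb{D}$ with $\varphi\in S^p$. Then the following are equivalent: (i) $D_\varphi:S^p\to S^p$ is bounded; (ii) $C_\varphi:H^p\to S^p$ is bounded; (iii) $DC_\varphi:H^p\to H^p$ is bounded.
   Context: $\mathbb{D}$ is the open unit disk. For $p>1$, $H^p$ is the Hardy space of analytic $g$ on $\mathbb{D}$ with $\|g\|_{H^p}^p=\sup_{0<r<1}\int_0^{2\pi}|g(re^{i\theta})|^p\frac{d\theta}{2\pi}<\infty$. $S^p$ is the space of analytic $f$ on $\mathbb{D}$ with $f'\in H^p$, normed by $\|f\|_{S^p}=|f(0)|+\|f'\|_{H^p}$. For an analytic self-map $\varphi$ of $\mathbb{D}$: $C_\varphi f=f\circ\varphi$, $D_\varphi f=f'\circ\varphi$, and $DC_\varphi f=(f\circ\varphi)'$. *)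

(* Defs.v *)
From Stdlib Require Import Reals ClassicalEpsilon.
From Coquelicot Require Import Coquelicot.
Open Scope R_scope.

(* x^p for x >= 0 and real p > 0, with the convention 0^p = 0
   (Stdlib's Rpower 0 p would be 1). *)
Definition powp (x p : R) : R := if Rle_dec x 0 then 0 else Rpower x p.

Definition inD (z : C) : Prop := Cmod z < 1.

(* f is analytic (complex differentiable) at every point of the disk.
   Functions are total maps C -> C; only their values on the disk matter. *)
Definition analytic_D (f : C -> C) : Prop :=
  forall z : C, inD z -> @ex_derive C_AbsRing C_NormedModule f z.

Definition cderiv (f : C -> C) (z : C) : C :=
  epsilon (inhabits (0 : C)) (fun l : C => @is_derive C_AbsRing C_NormedModule f z l).

Definition self_map_D (phi : C -> C) : Prop :=
  analytic_D phi /\ forall z, inD z -> inD (phi z).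

Definition Hp_mean (p : R) (g : C -> C) (r : R) : R :=
  RInt (fun t : R => powp (Cmod (g (r * cos t, r * sin t))) p) 0 (2 * PI) / (2 * PI).

Definition Hp_sup (p : R) (g : C -> C) : Rbar :=
  Lub_Rbar (fun x : R => exists r : R, 0 < r < 1 /\ x = Hp_mean p g r).

Definition in_Hp (p : R) (g : C -> C) : Prop :=
  analytic_D g /\ is_finite (Hp_sup p g).

Definition Hp_norm (p : R) (g : C -> C) : R := powp (real (Hp_sup p g)) (1 / p).

Definition in_Sp (p : R) (f : C -> C) : Prop :=
  analytic_D f /\ in_Hp p (cderiv f).

Definition Sp_norm (p : R) (f : C -> C) : R := Cmod (f 0) + Hp_norm p (cderiv f).

Definition bounded_op (inX : (C -> C) -> Prop) (nX : (C -> C) -> R)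
  (inY : (C -> C) -> Prop) (nY : (C -> C) -> R) (T : (C -> C) -> (C -> C)) : Prop :=
  (forall f, inX f -> inY (T f)) /\
  exists K : R, forall f, inX f -> nY (T f) <= K * nX f.

Definition Comp (phi : C -> C) (f : C -> C) : C -> C := fun z => f (phi z).
Definition Dphi (phi : C -> C) (f : C -> C) : C -> C := fun z => cderiv f (phi z).
Definition DComp (phi : C -> C) (f : C -> C) : C -> C := cderiv (fun z => f (phi z)).

(* Main.v *)
(** A primitive of [f] turns [f] in [H^p] into [F] in [S^p] with [F 0 = 0] and the
    same norm, and [D_phi F = C_phi f]; conversely [D_phi f = C_phi f'].  The
    [S^p]-norm of [C_phi f] exceeds the [H^p]-norm of [DC_phi f] by
    [|f (phi 0)|], so that the second equivalence amounts to the boundedness on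
    [H^p] of point evaluation at [phi 0].

    Both the primitive and Cauchy's formula come from Goursat's bisection argument,
    run in the parameter rectangle of a C^1 map into the disk, here always a cone
    [a + s (c t - a)] over a curve [c].  The cone over a segment with apex 0 gives
    the primitive.  The cone over [|z| = r] with apex [a], cut off at [s = delta],
    gives [int (f z - f a) / (z - a) dz = 0] when [delta] tends to 0.  The point
    evaluation follows since [Re (z / (z - a)) >= 1/2] on that circle, using
    [x <= lambda + lambda^(1-p) x^p] with [lambda] the [H^p]-norm of [f]. *)

Require Import Defs.
From Stdlib Require Import Reals Lra ClassicalEpsilon.
From Coquelicot Require Import Coquelicot.
Open Scope R_scope.

(** * Complex differentiability *)

Lemma is_C_derive_iff (f : C -> C) (z l : C) :
  @is_derive C_AbsRing C_NormedModule f z l <->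
  forall eps, 0 < eps -> exists delta, 0 < delta /\ forall w,
    Cmod (w - z) < delta -> Cmod (f w - f z - (w - z) * l) <= eps * Cmod (w - z).
Proof.
split.
- intros [_ H] eps He.
  destruct (H z (fun P HP => HP) (mkposreal eps He)) as [d Hd].
  exists d; split; [apply cond_pos|]. intros w Hw. exact (Hd w Hw).
- intros H; split; [apply is_linear_scal_l|].
  intros x Hx eps.
  (* [is_derive] asks for the estimate at every limit [x] of the neighbourhood filter of [z]; limits
     are unique, so [x] is [z]. *)
  assert (Hxz : z = x) by (apply (@is_filter_lim_locally_unique C_AbsRing (AbsRing_NormedModule C_AbsRing)); exact Hx).
  subst x.
  destruct (H eps (cond_pos eps)) as (d & Hd & K).
  exists (mkposreal d Hd). intros w Hw. exact (K w Hw).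
Qed.

Lemma is_CR_derive_iff (g : R -> C) (t : R) (d : C) :
  @is_derive R_AbsRing C_R_NormedModule g t d <->
  forall eps, 0 < eps -> exists delta, 0 < delta /\ forall u,
    Rabs (u - t) < delta -> Cmod (g u - g t - RtoC (u - t) * d) <= eps * Rabs (u - t).
Proof.
assert (E : forall u, minus (minus (g u) (g t)) (scal (minus u t) d) = (g u - g t - RtoC (u - t) * d)%C).
{ intros u. unfold minus, plus, opp, scal; simpl. unfold prod_plus, prod_opp, prod_scal, plus, opp, scal; simpl; unfold mult; simpl.
  apply injective_projections; simpl; ring. }
split.
- intros [_ H] eps He.
  destruct (H t (fun P HP => HP) (mkposreal eps He)) as [r Hr].
  exists r; split; [apply cond_pos|]. intros w Hw. rewrite <- E, Cmod_norm. exact (Hr w Hw).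
- intros H; split; [apply is_linear_scal_l|].
  intros x Hx eps.
  assert (Hxz : t = x) by (apply (@is_filter_lim_locally_unique R_AbsRing (AbsRing_NormedModule R_AbsRing)); exact Hx).
  subst x.
  destruct (H eps (cond_pos eps)) as (r & Hd & K).
  exists (mkposreal r Hd). intros w Hw. 
  specialize (K w Hw). rewrite <- E, Cmod_norm in K. exact K.
Qed.

Lemma C_derive_continuous (f : C -> C) (z l : C) :
  @is_derive C_AbsRing C_NormedModule f z l ->
  forall eps, 0 < eps -> exists delta, 0 < delta /\ forall w,
    Cmod (w - z) < delta -> Cmod (f w - f z) < eps.
Proof.
intros H eps He.
destruct (proj1 (is_C_derive_iff f z l) H 1 Rlt_0_1) as (d & Hd & K).
assert (Hl := Cmod_ge_0 l).
exists (Rmin d (eps / (2 + Cmod l))).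
assert (0 < eps / (2 + Cmod l)) by (apply Rdiv_lt_0_compat; lra).
split; [now apply Rmin_pos|].
intros w Hw.
assert (Hw1 := Rlt_le_trans _ _ _ Hw (Rmin_l _ _)).
assert (Hw2 := Rlt_le_trans _ _ _ Hw (Rmin_r _ _)).
specialize (K w Hw1).
replace (f w - f z)%C with ((f w - f z - (w - z) * l) + (w - z) * l)%C by ring.
eapply Rle_lt_trans; [apply Cmod_triangle|]. rewrite Cmod_mult.
assert (Hw0 := Cmod_ge_0 (w - z)).
apply (Rmult_lt_compat_r (2 + Cmod l)) in Hw2; [|lra].
unfold Rdiv in Hw2; rewrite Rmult_assoc, Rinv_l, Rmult_1_r in Hw2; lra.
Qed.

(** Chain rule with a complex derivative outside and a real one inside. The remainder is that of [f]
    at [g t] plus [l] times that of [g]. *)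
Lemma is_derive_C_comp_path (f : C -> C) (g : R -> C) (t : R) (l d : C) :
  @is_derive C_AbsRing C_NormedModule f (g t) l ->
  @is_derive R_AbsRing C_R_NormedModule g t d ->
  @is_derive R_AbsRing C_R_NormedModule (fun u => f (g u)) t (l * d)%C.
Proof.
intros Hf Hg. apply is_CR_derive_iff. intros eps He.
rewrite is_C_derive_iff in Hf. rewrite is_CR_derive_iff in Hg.
assert (Hl := Cmod_ge_0 l). assert (Hd := Cmod_ge_0 d).
(* With these constants each of the two remainders is at most [eps / 2 * Rabs (u - t)]; the cap
   [e2 <= 1] makes [1 + Cmod d] a Lipschitz constant of [g] at [t]. *)
set (e1 := eps / (2 * (1 + Cmod d))). set (e2 := Rmin 1 (eps / (2 * (1 + Cmod l)))).
assert (He1 : 0 < e1) by (apply Rdiv_lt_0_compat; lra).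
assert (He2 : 0 < e2) by (apply Rmin_pos; [lra|apply Rdiv_lt_0_compat; lra]).
destruct (Hf e1 He1) as (d1 & Hd1 & K1).
destruct (Hg e2 He2) as (d2 & Hd2 & K2).
exists (Rmin d2 (d1 / (1 + Cmod d))).
split; [apply Rmin_pos; [lra|apply Rdiv_lt_0_compat; lra]|].
intros u Hu.
assert (Hu1 := Rlt_le_trans _ _ _ Hu (Rmin_l _ _)).
assert (Hu2 := Rlt_le_trans _ _ _ Hu (Rmin_r _ _)).
specialize (K2 u Hu1).
assert (Hau := Rabs_pos (u - t)).
assert (e2 <= 1) by apply Rmin_l.
assert (e2 * (1 + Cmod l) <= eps / 2).
{ apply Rle_trans with (eps / (2 * (1 + Cmod l)) * (1 + Cmod l)).
  - apply Rmult_le_compat_r; [lra|apply Rmin_r].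
  - right; field; lra. }
assert (e1 * (1 + Cmod d) = eps / 2) by (unfold e1; field; lra).
assert (B : Cmod (g u - g t) <= (1 + Cmod d) * Rabs (u - t)).
{ replace (g u - g t)%C with ((g u - g t - RtoC (u - t) * d) + RtoC (u - t) * d)%C by ring.
  eapply Rle_trans; [apply Cmod_triangle|]. rewrite Cmod_mult, Cmod_R. nra. }
assert (Cmod (g u - g t) < d1).
{ apply Rle_lt_trans with (1 := B).
  apply (Rmult_lt_compat_l (1 + Cmod d)) in Hu2; [|lra].
  replace ((1 + Cmod d) * (d1 / (1 + Cmod d))) with d1 in Hu2 by (field; lra). exact Hu2. }
specialize (K1 _ H2).
replace (f (g u) - f (g t) - RtoC (u - t) * (l * d))%C with
  ((f (g u) - f (g t) - (g u - g t) * l) + l * (g u - g t - RtoC (u - t) * d))%C by ring.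
eapply Rle_trans; [apply Cmod_triangle|]. rewrite Cmod_mult.
assert (e1 * Cmod (g u - g t) <= eps / 2 * Rabs (u - t)).
{ rewrite <- H1, Rmult_assoc. apply Rmult_le_compat_l; lra. }
assert (Cmod l * Cmod (g u - g t - RtoC (u - t) * d) <= (1 + Cmod l) * (e2 * Rabs (u-t))).
{ apply Rmult_le_compat; try lra; apply Cmod_ge_0. }
nra.
Qed.

Lemma continuous_CR_mult (f g : R -> C) (t : R) :
  @continuous R_UniformSpace C_UniformSpace f t -> @continuous R_UniformSpace C_UniformSpace g t ->
  @continuous R_UniformSpace C_UniformSpace (fun u => f u * g u)%C t.
Proof.
intros Hf Hg.
assert (Hf1 : continuous (fun u => fst (f u)) t) by (apply continuous_comp with (1 := Hf); destruct (f t); apply continuous_fst).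
assert (Hf2 : continuous (fun u => snd (f u)) t) by (apply continuous_comp with (1 := Hf); destruct (f t); apply continuous_snd).
assert (Hg1 : continuous (fun u => fst (g u)) t) by (apply continuous_comp with (1 := Hg); destruct (g t); apply continuous_fst).
assert (Hg2 : continuous (fun u => snd (g u)) t) by (apply continuous_comp with (1 := Hg); destruct (g t); apply continuous_snd).
unfold Cmult.
apply (continuous_comp_2 (fun u => fst (f u) * fst (g u) - snd (f u) * snd (g u)) (fun u => fst (f u) * snd (g u) + snd (f u) * fst (g u)) (fun x y => (x, y) : C)).
- apply (continuous_minus (V := R_NormedModule)); apply (continuous_mult (K := R_AbsRing)); assumption.
- apply (continuous_plus (V := R_NormedModule)); apply (continuous_mult (K := R_AbsRing)); assumption.
- apply continuous_ext with (fun x => x); [now intros []|apply continuous_id].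
Qed.

Lemma continuous_CR_derive (g : R -> C) (t : R) (d : C) :
  @is_derive R_AbsRing C_R_NormedModule g t d -> @continuous R_UniformSpace C_UniformSpace g t.
Proof. intros H. apply (ex_derive_continuous (V := C_R_NormedModule)). now exists d. Qed.

(** * Integrals along curves *)

(** The derivative is carried as data, and the conditions hold on all of [R], so that no one-sided
    derivatives arise at the ends of an interval. *)
Definition C1_path (g dg : R -> C) : Prop := forall t,
  @is_derive R_AbsRing C_R_NormedModule g t (dg t) /\
  @continuous R_UniformSpace C_UniformSpace dg t.

Definition path_int (f : C -> C) (g dg : R -> C) (a b : R) : C :=
  @RInt C_R_CompleteNormedModule (fun t => f (g t) * dg t)%C a b.

Lemma continuous_path_integrand (f : C -> C) (g dg : R -> C) (t : R) :
  C1_path g dg -> @ex_derive C_AbsRing C_NormedModule f (g t) ->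
  @continuous R_UniformSpace C_UniformSpace (fun u => f (g u) * dg u)%C t.
Proof.
intros Hg [l Hl]. destruct (Hg t) as [Hd Hc].
apply continuous_CR_mult; [|exact Hc].
eapply continuous_CR_derive, is_derive_C_comp_path; eassumption.
Qed.

Lemma ex_path_int (f : C -> C) (g dg : R -> C) (a b : R) :
  C1_path g dg -> a <= b ->
  (forall t, a <= t <= b -> @ex_derive C_AbsRing C_NormedModule f (g t)) ->
  @ex_RInt C_R_NormedModule (fun t => f (g t) * dg t)%C a b.
Proof.
intros Hg Hab Hf. apply (ex_RInt_continuous (V := C_R_CompleteNormedModule)).
intros t Ht. rewrite Rmin_left, Rmax_right in Ht by exact Hab.
apply continuous_path_integrand; auto.
Qed.

Lemma path_int_Chasles (f : C -> C) (g dg : R -> C) (a b c : R) :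
  C1_path g dg -> a <= b <= c ->
  (forall t, a <= t <= c -> @ex_derive C_AbsRing C_NormedModule f (g t)) ->
  path_int f g dg a c = (path_int f g dg a b + path_int f g dg b c)%C.
Proof.
intros Hg Habc Hf. symmetry.
apply (RInt_Chasles (V := C_R_CompleteNormedModule));
  apply ex_path_int; try assumption; try lra; intros; apply Hf; lra.
Qed.

(** A primitive of the affine function [al + be * (w - z0)]; the remainder is exactly
    [be / 2 * (w - z)^2]. *)
Lemma is_derive_C_quadratic (al be z0 z : C) :
  @is_derive C_AbsRing C_NormedModule
    (fun w => al * (w - z0) + be / 2 * ((w - z0) * (w - z0)))%C z (al + be * (z - z0))%C.
Proof.
apply is_C_derive_iff. intros eps He. assert (Hb := Cmod_ge_0 (be / 2)).
exists (eps / (1 + Cmod (be / 2))). split; [apply Rdiv_lt_0_compat; lra|].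
intros w Hw.
match goal with |- Cmod ?x <= _ => replace x with (be / 2 * (w - z) * (w - z))%C end.
2:{ field. }
rewrite !Cmod_mult. apply Rmult_le_compat_r; [apply Cmod_ge_0|].
apply (Rmult_lt_compat_l (1 + Cmod (be / 2))) in Hw; [|lra].
replace ((1 + Cmod (be / 2)) * (eps / (1 + Cmod (be / 2)))) with eps in Hw by (field; lra).
assert (H := Cmod_ge_0 (w - z)). nra.
Qed.

(** The affine part has the primitive [Q] and integrates to [Q (g b) - Q (g a)]. The rest of the
    integrand is bounded by [e * L]. *)
Lemma path_int_near_affine (f : C -> C) (g dg : R -> C) (a b e L : R) (al be z0 : C) :
  let Q w := (al * (w - z0) + be / 2 * ((w - z0) * (w - z0)))%C in
  C1_path g dg -> a <= b ->
  (forall t, a <= t <= b -> @ex_derive C_AbsRing C_NormedModule f (g t)) ->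
  (forall t, a <= t <= b -> Cmod (dg t) <= L) ->
  (forall t, a <= t <= b -> Cmod (f (g t) - (al + be * (g t - z0))) <= e) ->
  Cmod (path_int f g dg a b - (Q (g b) - Q (g a))) <= (b - a) * (e * L).
Proof.
intros Q Hg Hab Hf HL He.
assert (I1 := RInt_correct (V := C_R_CompleteNormedModule) _ _ _ (ex_path_int f g dg a b Hg Hab Hf)).
assert (I2 : @is_RInt C_R_NormedModule (fun t => (al + be * (g t - z0)) * dg t)%C a b (Q (g b) - Q (g a))%C).
{ apply (is_RInt_derive (V := C_R_CompleteNormedModule) (fun t => Q (g t))).
  - intros t _. apply is_derive_C_comp_path; [apply is_derive_C_quadratic|apply Hg].
  - intros t _. apply (continuous_path_integrand (fun w => al + be * (w - z0))%C); [exact Hg|].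
    exists be. apply is_C_derive_iff. intros eps Heps. exists 1. split; [lra|]. intros w _.
    match goal with |- Cmod ?x <= _ => replace x with (0 : C) by ring end.
    rewrite Cmod_0. apply Rmult_le_pos; [lra|apply Cmod_ge_0]. }
assert (I3 := is_RInt_minus (V := C_R_NormedModule) _ _ _ _ _ _ I1 I2).
rewrite Cmod_norm. apply (norm_RInt_le_const (V := C_R_NormedModule)) with (3 := I3); [exact Hab|].
intros t Ht. eapply Rle_trans; [right; symmetry; apply Cmod_norm|].
change (Cmod (f (g t) * dg t - (al + be * (g t - z0)) * dg t)%C <= e * L).
replace (f (g t) * dg t - (al + be * (g t - z0)) * dg t)%C with ((f (g t) - (al + be * (g t - z0))) * dg t)%C by ring.
rewrite Cmod_mult. apply Rmult_le_compat; auto using Cmod_ge_0.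
Qed.

(** * Goursat's theorem on the image of a rectangle *)

(* [A] and [B] are the partial derivatives of [G] in the first and second variable. *)
Definition C1_square (G A B : R -> R -> C) : Prop :=
  (forall t, C1_path (fun s => G s t) (fun s => A s t)) /\
  (forall s, C1_path (G s) (B s)).

(* The integral of [f z dz] along the image under [G] of the boundary of [a,b] x [c,d]. *)
Definition rect_int (f : C -> C) (G A B : R -> R -> C) (a b c d : R) : C :=
  (path_int f (fun s => G s c) (fun s => A s c) a b + path_int f (G b) (B b) c d
   - path_int f (fun s => G s d) (fun s => A s d) a b - path_int f (G a) (B a) c d)%C.

(** Each outer side is cut in two, and each inner side occurs twice with opposite signs. *)
Lemma rect_int_split (f : C -> C) (G A B : R -> R -> C) (a m b c n d : R) :
  C1_square G A B -> a <= m <= b -> c <= n <= d ->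
  (forall s t, a <= s <= b -> c <= t <= d -> @ex_derive C_AbsRing C_NormedModule f (G s t)) ->
  rect_int f G A B a b c d =
   (rect_int f G A B a m c n + rect_int f G A B m b c n
    + rect_int f G A B a m n d + rect_int f G A B m b n d)%C.
Proof.
intros [HA HB] Hm Hn Hf. unfold rect_int.
rewrite (path_int_Chasles f (fun s => G s c) (fun s => A s c) a m b),
  (path_int_Chasles f (fun s => G s d) (fun s => A s d) a m b),
  (path_int_Chasles f (G a) (B a) c n d), (path_int_Chasles f (G b) (B b) c n d); auto;
  try (intros; apply Hf; lra).
ring.
Qed.

(** The increments of [Q] along the four sides cancel at the corners, so only the errors of the
    sides remain. *)
Lemma rect_int_near_affine (f : C -> C) (G A B : R -> R -> C) (a b c d e L : R) (al be z0 : C) :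
  C1_square G A B -> a <= b -> c <= d ->
  (forall s t, a <= s <= b -> c <= t <= d ->
     @ex_derive C_AbsRing C_NormedModule f (G s t) /\ Cmod (A s t) <= L /\ Cmod (B s t) <= L /\
     Cmod (f (G s t) - (al + be * (G s t - z0))) <= e) ->
  Cmod (rect_int f G A B a b c d) <= 2 * ((b - a) + (d - c)) * (e * L).
Proof.
intros [HA HB] Hab Hcd H.
set (Q w := (al * (w - z0) + be / 2 * ((w - z0) * (w - z0)))%C).
assert (E1 := path_int_near_affine f (fun s => G s c) (fun s => A s c) a b e L al be z0 (HA c) Hab).
assert (E2 := path_int_near_affine f (fun s => G s d) (fun s => A s d) a b e L al be z0 (HA d) Hab).
assert (E3 := path_int_near_affine f (G a) (B a) c d e L al be z0 (HB a) Hcd).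
assert (E4 := path_int_near_affine f (G b) (B b) c d e L al be z0 (HB b) Hcd).
fold Q in E1, E2, E3, E4. cbv beta zeta in E1, E2, E3, E4.
do 3 (lapply E1; [clear E1; intros E1|intros; apply H; lra]).
do 3 (lapply E2; [clear E2; intros E2|intros; apply H; lra]).
do 3 (lapply E3; [clear E3; intros E3|intros; apply H; lra]).
do 3 (lapply E4; [clear E4; intros E4|intros; apply H; lra]).
unfold rect_int.
match type of E1 with Cmod ?x <= _ => match type of E2 with Cmod ?y <= _ => 
match type of E3 with Cmod ?z <= _ => match type of E4 with Cmod ?u <= _ => 
 match goal with |- Cmod ?v <= _ => replace v with (x + u + - y + - z)%C by ring end end end end end.
eapply Rle_trans; [apply Cmod_triangle|].
eapply Rle_trans; [apply Rplus_le_compat_r, Cmod_triangle|].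
eapply Rle_trans; [apply Rplus_le_compat_r, Rplus_le_compat_r, Cmod_triangle|].
rewrite !Cmod_opp. lra.
Qed.

(** The intervals [[u n, u n + h / 2^n]] are nested, so every left end lies below every right end;
    [x] is the supremum of the left ends. *)
Lemma nested_halving (u : nat -> R) (h : R) :
  0 <= h ->
  (forall n, u (S n) = u n \/ u (S n) = u n + h / 2 ^ S n) ->
  exists x, forall n, u n <= x <= u n + h / 2 ^ n.
Proof.
intros Hh Hu.
assert (P : forall n, 0 <= h / 2 ^ n).
{ intros n. apply Rdiv_le_0_compat; [exact Hh|]. apply pow_lt; lra. }
assert (E : forall n, h / 2 ^ n = h / 2 ^ S n + h / 2 ^ S n).
{ intros n. simpl. field. apply pow_nonzero. lra. }
assert (M : forall n k, u n <= u (k + n)%nat /\ u (k + n)%nat + h / 2 ^ (k + n) <= u n + h / 2 ^ n).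
{ intros n k. induction k as [|k IH]; [simpl; lra|].
  change (S k + n)%nat with (S (k + n)).
  assert (Z := P (S (k + n))). assert (Z1 := E (k + n)%nat). destruct (Hu (k + n)%nat) as [->| ->]; lra. }
assert (UB : forall m n, u m <= u n + h / 2 ^ n).
{ intros m n. destruct (M m n) as [X1 _]. destruct (M n m) as [_ X2].
  rewrite (Nat.add_comm m n) in X2. assert (Z := P (n + m)%nat). lra. }
destruct (completeness (fun x => exists n, x = u n)) as [x [Hx1 Hx2]].
- exists (u O + h / 2 ^ 0). intros y [n ->]. apply UB.
- now exists (u O), O.
- exists x. intros n. split.
  + apply Hx1. now exists n.
  + apply Hx2. intros y [m ->]. apply UB.
Qed.

Lemma C1_path_lipschitz (g dg : R -> C) (a b x y L : R) :
  C1_path g dg -> a <= x <= b -> a <= y <= b -> (forall t, a <= t <= b -> Cmod (dg t) <= L) ->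
  Cmod (g y - g x) <= L * Rabs (y - x).
Proof.
intros Hg.
assert (W : forall x y, a <= x <= b -> a <= y <= b -> (forall t, a <= t <= b -> Cmod (dg t) <= L) ->
  x <= y -> Cmod (g y - g x) <= L * (y - x)).
{ intros u v Hu Hv HL Huv. rewrite Rmult_comm, Cmod_norm.
  apply (norm_RInt_le_const (V := C_R_NormedModule) dg u v); [exact Huv| |].
  - intros t Ht. eapply Rle_trans; [right; symmetry; apply Cmod_norm|]. apply HL; lra.
  - apply (is_RInt_derive (V := C_R_CompleteNormedModule)); intros t _; apply Hg. }
intros Hx Hy HL. destruct (Rle_dec x y).
- rewrite Rabs_right by lra. auto.
- rewrite <- Cmod_opp, Rabs_left by lra.
  replace (- (g y - g x))%C with (g x - g y)%C by ring.
  replace (- (y - x)) with (x - y) by ring. apply W; auto; lra.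
Qed.

(** Passing to a suitable quarter loses at most a factor 4. Near the common point of the chosen
    rectangles [f] is affine up to [eps] times the distance; distance and perimeter both shrink like
    [2^-n], which compensates the factor [4^n]. *)
Lemma goursat_square (f : C -> C) (G A B : R -> R -> C) (a b c d L : R) :
  C1_square G A B -> a <= b -> c <= d ->
  (forall s t, a <= s <= b -> c <= t <= d ->
     @ex_derive C_AbsRing C_NormedModule f (G s t) /\ Cmod (A s t) <= L /\ Cmod (B s t) <= L) ->
  rect_int f G A B a b c d = 0.
Proof.
intros HG Hab Hcd H.
set (h := b - a). set (k := d - c).
assert (Hh : 0 <= h) by (unfold h; lra). assert (Hk : 0 <= k) by (unfold k; lra).
assert (P : forall x n, 0 <= x -> 0 <= x / 2 ^ n).
{ intros x n Hx. apply Rdiv_le_0_compat; [exact Hx|]. apply pow_lt; lra. }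
assert (E : forall x n, x / 2 ^ n = x / 2 ^ S n + x / 2 ^ S n).
{ intros x n. simpl. field. apply pow_nonzero. lra. }
(* A rectangle of generation [n] is recorded by its lower left corner [p] alone; its sides are
   [h / 2^n] and [k / 2^n]. *)
set (J n (p : R * R) := rect_int f G A B (fst p) (fst p + h / 2 ^ n) (snd p) (snd p + k / 2 ^ n)).
set (inside n (p : R * R) := (a <= fst p /\ fst p + h / 2 ^ n <= b) /\ (c <= snd p /\ snd p + k / 2 ^ n <= d)).
set (step n (p q : R * R) := (fst q = fst p \/ fst q = fst p + h / 2 ^ S n) /\
  (snd q = snd p \/ snd q = snd p + k / 2 ^ S n) /\ Cmod (J n p) <= 4 * Cmod (J (S n) q)).
assert (Hstep : forall n p, inside n p -> exists q, step n p q).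
(* If every quarter carried less than a fourth of the modulus, the four could not add up to the
   whole. *)
{ intros n [s t] [Hs Ht]. simpl in Hs, Ht. apply NNPP. intros N.
  set (s' := s + h / 2 ^ S n). set (t' := t + k / 2 ^ S n).
  assert (Hs0 := P h (S n) Hh). assert (Ht0 := P k (S n) Hk).
  assert (Hs1 := E h n). assert (Ht1 := E k n).
  assert (X : forall x y, (x = s \/ x = s') -> (y = t \/ y = t') -> 4 * Cmod (J (S n) (x, y)) < Cmod (J n (s, t))).
  { intros x y Hx Hy. apply Rnot_le_lt. intros HJ. apply N. exists (x, y). now repeat split. }
  assert (D : J n (s, t) = (J (S n) (s, t) + J (S n) (s', t) + J (S n) (s, t') + J (S n) (s', t'))%C).
  { unfold J. cbn [fst snd]. rewrite (rect_int_split f G A B s s' _ t t' _).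
    - replace (s' + h / 2 ^ S n) with (s + h / 2 ^ n) by (unfold s'; lra).
      replace (t' + k / 2 ^ S n) with (t + k / 2 ^ n) by (unfold t'; lra). reflexivity.
    - exact HG.
    - unfold s'; lra.
    - unfold t'; lra.
    - intros; apply H; lra. }
  assert (X1 := X s t (or_introl eq_refl) (or_introl eq_refl)).
  assert (X2 := X s' t (or_intror eq_refl) (or_introl eq_refl)).
  assert (X3 := X s t' (or_introl eq_refl) (or_intror eq_refl)).
  assert (X4 := X s' t' (or_intror eq_refl) (or_intror eq_refl)).
  assert (T : Cmod (J n (s, t)) <= Cmod (J (S n) (s, t)) + Cmod (J (S n) (s', t)) + Cmod (J (S n) (s, t')) + Cmod (J (S n) (s', t'))).
  { rewrite D at 1. eapply Rle_trans; [apply Cmod_triangle|].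
    eapply Rle_trans; [apply Rplus_le_compat_r, Cmod_triangle|].
    eapply Rle_trans; [apply Rplus_le_compat_r, Rplus_le_compat_r, Cmod_triangle|]. lra. }
  lra. }
(* [epsilon] picks a good quarter at each generation; its specification applies because all
   rectangles stay inside, as [Iu] shows by induction. *)
set (u := fix u n : R * R := match n with O => (a, c) | S m => epsilon (inhabits (0, 0)) (step m (u m)) end).
assert (Hu : forall n, inside n (u n) -> step n (u n) (u (S n))).
{ intros n Hn. simpl. apply epsilon_spec. now apply Hstep. }
assert (Iu : forall n, inside n (u n)).
{ induction n as [|n IH].
  - unfold inside, h, k; simpl. lra.
  - destruct (Hu n IH) as (S1 & S2 & _). destruct IH as [I1 I2].
    assert (Hs0 := P h (S n) Hh). assert (Ht0 := P k (S n) Hk).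
    assert (Hs1 := E h n). assert (Ht1 := E k n).
    split; [destruct S1 as [-> | ->]|destruct S2 as [-> | ->]]; lra. }
assert (JJ : forall n, Cmod (rect_int f G A B a b c d) <= 4 ^ n * Cmod (J n (u n))).
{ induction n as [|n IH].
  - unfold J, h, k. simpl. replace (a + (b - a) / 1) with b by field.
    replace (c + (d - c) / 1) with d by field. lra.
  - apply Rle_trans with (1 := IH). destruct (Hu n (Iu n)) as (_ & _ & S3).
    replace (4 ^ S n * Cmod (J (S n) (u (S n)))) with (4 ^ n * (4 * Cmod (J (S n) (u (S n))))) by (simpl; ring).
    apply Rmult_le_compat_l; [apply pow_le; lra|exact S3]. }
destruct (nested_halving (fun n => fst (u n)) h Hh) as [s Hs]; [intros n; apply (Hu n (Iu n))|].
destruct (nested_halving (fun n => snd (u n)) k Hk) as [t Ht]; [intros n; apply (Hu n (Iu n))|].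
assert (Hs0 : a <= s <= b).
{ assert (Z := Hs O). simpl in Z. unfold h in Z. lra. }
assert (Ht0 : c <= t <= d).
{ assert (Z := Ht O). simpl in Z. unfold k in Z. lra. }
destruct (H s t Hs0 Ht0) as ([l Hl] & HL & _).
assert (HL0 : 0 <= L) by (eapply Rle_trans; [apply Cmod_ge_0|exact HL]).
apply Cmod_eq_0. apply Rle_antisym; [|apply Cmod_ge_0].
apply Rnot_lt_le. intros Hpos.
(* [eps * M] is what remains of the bound on [J n (u n)] after multiplication by [4^n]. The choice
   of [eps] keeps it below the modulus of the whole integral; the [+ 1] covers [M = 0]. *)
set (M := 2 * (h + k) * (L * (h + k) * L)).
assert (HM : 0 <= M).
{ unfold M. apply Rmult_le_pos; [lra|]. apply Rmult_le_pos; [|lra]. apply Rmult_le_pos; lra. }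
set (eps := Cmod (rect_int f G A B a b c d) / (2 * (M + 1))).
assert (Heps : 0 < eps) by (apply Rdiv_lt_0_compat; lra).
destruct (proj1 (is_C_derive_iff f _ l) Hl eps Heps) as (del & Hdel & K).
(* [n] is so large that [G] maps the rectangle of generation [n] into the disk of radius [del]
   around [G s t]. *)
destruct (pow_lt_1_zero (/ 2)) with (y := del / (L * (h + k) + 1)) as [n Hn].
{ rewrite Rabs_right; lra. }
{ apply Rdiv_lt_0_compat; [lra|]. assert (0 <= L * (h + k)) by (apply Rmult_le_pos; lra). lra. }
specialize (Hn n (Nat.le_refl n)).
assert (H2n : 0 < 2 ^ n) by (apply pow_lt; lra).
rewrite Rabs_right in Hn by (apply Rle_ge, pow_le; lra).
rewrite pow_inv in Hn.
assert (Hsmall : L * (h + k) / 2 ^ n < del).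
{ assert (0 <= L * (h + k)) by (apply Rmult_le_pos; lra).
  assert (0 < / 2 ^ n) by now apply Rinv_0_lt_compat.
  apply (Rmult_lt_compat_l (L * (h + k) + 1)) in Hn; [|lra].
  replace ((L * (h + k) + 1) * (del / (L * (h + k) + 1))) with del in Hn by (field; lra).
  unfold Rdiv. lra. }
assert (Hn1 : Cmod (J n (u n)) <= 2 * (h / 2 ^ n + k / 2 ^ n) * (eps * (L * (h + k) / 2 ^ n) * L)).
{ destruct (Iu n) as [I1 I2]. assert (Hsn := Hs n). assert (Htn := Ht n). simpl in Hsn, Htn.
  assert (Ph := P h n Hh). assert (Pk := P k n Hk).
  unfold J.
  replace (h / 2 ^ n + k / 2 ^ n) with ((fst (u n) + h / 2 ^ n - fst (u n)) + (snd (u n) + k / 2 ^ n - snd (u n))) by ring.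
  apply rect_int_near_affine with (al := f (G s t)) (be := l) (z0 := G s t); [exact HG|lra|lra|].
  intros x y Hx Hy.
  destruct (H x y) as (X1 & X2 & X3); [lra|lra|].
  repeat split; try assumption.
  assert (Dist : Cmod (G x y - G s t) <= L * (h + k) / 2 ^ n).
  { replace (G x y - G s t)%C with ((G x y - G s y) + (G s y - G s t))%C by ring.
    eapply Rle_trans; [apply Cmod_triangle|].
    replace (L * (h + k) / 2 ^ n) with (L * (h / 2 ^ n) + L * (k / 2 ^ n)) by (field; lra).
    apply Rplus_le_compat.
    - eapply Rle_trans; [apply (C1_path_lipschitz (fun s => G s y) (fun s => A s y) a b s x L)|].
      + apply HG.
      + lra.
      + lra.
      + intros; apply H; lra.
      + apply Rmult_le_compat_l; [lra|]. apply Rabs_le; lra.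
    - eapply Rle_trans; [apply (C1_path_lipschitz (G s) (B s) c d t y L)|].
      + apply HG.
      + lra.
      + lra.
      + intros; apply H; lra.
      + apply Rmult_le_compat_l; [lra|]. apply Rabs_le; lra. }
  replace (f (G x y) - (f (G s t) + l * (G x y - G s t)))%C with
    (f (G x y) - f (G s t) - (G x y - G s t) * l)%C by ring.
  eapply Rle_trans; [apply K; lra|]. apply Rmult_le_compat_l; lra. }
assert (F := JJ n).
assert (4 ^ n = 2 ^ n * 2 ^ n) as E4 by (rewrite <- Rpow_mult_distr; f_equal; lra).
apply (Rmult_le_compat_l (4 ^ n)) in Hn1; [|apply pow_le; lra].
replace (4 ^ n * (2 * (h / 2 ^ n + k / 2 ^ n) * (eps * (L * (h + k) / 2 ^ n) * L))) with (eps * M) in Hn1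
  by (rewrite E4; unfold M; field; lra).
assert (eps * (2 * (M + 1)) = Cmod (rect_int f G A B a b c d)) by (unfold eps; field; lra).
assert (0 < eps * (M + 2)) by (apply Rmult_lt_0_compat; lra).
lra.
Qed.

(** * Primitives *)

Lemma is_CR_derive_affine (u v : C) (t : R) :
  @is_derive R_AbsRing C_R_NormedModule (fun s => u + RtoC s * v)%C t v.
Proof.
apply is_CR_derive_iff. intros eps He. exists 1. split; [lra|]. intros s _.
match goal with |- Cmod ?x <= _ => replace x with (0 : C) by (rewrite RtoC_minus; ring) end.
rewrite Cmod_0. apply Rmult_le_pos; [lra|apply Rabs_pos].
Qed.

Lemma is_CR_derive_affine_comp (u v : C) (c : R -> C) (dc : C) (t : R) :
  @is_derive R_AbsRing C_R_NormedModule c t dc ->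
  @is_derive R_AbsRing C_R_NormedModule (fun s => u + v * c s)%C t (v * dc)%C.
Proof.
intros H. apply (is_derive_C_comp_path (fun w => u + v * w)%C c t v dc); [|exact H].
apply is_C_derive_iff. intros eps He. exists 1. split; [lra|]. intros w _.
match goal with |- Cmod ?x <= _ => replace x with (0 : C) by ring end.
rewrite Cmod_0. apply Rmult_le_pos; [lra|apply Cmod_ge_0].
Qed.

Lemma C1_path_segment (u v : C) : C1_path (fun s => u + RtoC s * v)%C (fun _ => v).
Proof. intros t. split; [apply is_CR_derive_affine|apply continuous_const]. Qed.

(** The side [s = 0] collapses to the apex, the side [s = 1] is the curve, and the lines of constant
    [t] are segments issuing from the apex. *)
Lemma C1_square_cone (a : C) (c dc : R -> C) :
  C1_path c dc ->
  C1_square (fun s t => a + RtoC s * (c t - a))%C (fun s t => c t - a)%C (fun s t => RtoC s * dc t)%C.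
Proof.
intros Hc. split.
- intros t. apply C1_path_segment.
- intros s t. destruct (Hc t) as [H1 H2]. split.
  + eapply is_derive_ext; [|exact (is_CR_derive_affine_comp (a - RtoC s * a) (RtoC s) c (dc t) t H1)].
    intros x. simpl. ring.
  + apply continuous_CR_mult; [apply continuous_const|exact H2].
Qed.

Lemma path_int_ext (f : C -> C) (g1 dg1 g2 dg2 : R -> C) (a b : R) :
  (forall t, Rmin a b < t < Rmax a b -> (f (g1 t) * dg1 t = f (g2 t) * dg2 t)%C) ->
  path_int f g1 dg1 a b = path_int f g2 dg2 a b.
Proof. intros H. apply (RInt_ext (V := C_R_CompleteNormedModule)), H. Qed.

Lemma path_int_zero (f : C -> C) (g dg : R -> C) (a b : R) :
  (forall t, dg t = 0) -> path_int f g dg a b = 0.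
Proof.
intros H. unfold path_int.
rewrite (RInt_ext (V := C_R_CompleteNormedModule) _ (fun _ => zero)).
- rewrite RInt_const. exact (scal_zero_r (V := C_R_NormedModule) (b - a)).
- intros t _. rewrite H. apply Cmult_0_r.
Qed.

(** [F z] is the integral along the radius to [z]. Goursat on the triangle [0], [z], [w] makes
    [F w - F z] the integral over the segment from [z] to [w], where [f] is close to [f z]. *)
Lemma analytic_D_primitive (f : C -> C) : analytic_D f ->
  exists F : C -> C, F 0 = 0 /\ forall z, inD z -> @is_derive C_AbsRing C_NormedModule F z (f z).
Proof.
intros Hf.
exists (fun z => path_int f (fun s => 0 + RtoC s * z)%C (fun _ => z) 0 1).
split; [now apply path_int_zero|].
intros z Hz. unfold inD in Hz. apply is_C_derive_iff. intros eps He.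
destruct (Hf z Hz) as [l Hl].
destruct (C_derive_continuous f z l Hl eps He) as (d & Hd & K).
(* The bound [1 - Cmod z] keeps the segment from [z] to [w], and with it the triangle, inside the
   disk. *)
exists (Rmin d (1 - Cmod z)). split; [apply Rmin_pos; lra|].
intros w Hw.
assert (Hw1 := Rlt_le_trans _ _ _ Hw (Rmin_l _ _)).
assert (Hw2 := Rlt_le_trans _ _ _ Hw (Rmin_r _ _)).
set (h := (w - z)%C) in *.
assert (Hh := Cmod_ge_0 h). assert (Hz0 := Cmod_ge_0 z).
set (c := fun t => (z + RtoC t * h)%C).
assert (Hc : forall t, 0 <= t <= 1 -> Cmod (RtoC t * h) <= Cmod h).
{ intros t Ht. rewrite Cmod_mult, Cmod_R, Rabs_right by lra. nra. }
assert (Hc' : forall t, 0 <= t <= 1 -> Cmod (c t) < 1).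
{ intros t Ht. unfold c. eapply Rle_lt_trans; [apply Cmod_triangle|]. specialize (Hc t Ht). lra. }
assert (Hin : forall s t, 0 <= s <= 1 -> 0 <= t <= 1 -> inD (0 + RtoC s * (c t - 0))%C).
{ intros s t Hs Ht. unfold inD. replace (0 + RtoC s * (c t - 0))%C with (RtoC s * c t)%C by ring.
  rewrite Cmod_mult, Cmod_R, Rabs_right by lra. specialize (Hc' t Ht). assert (Z := Cmod_ge_0 (c t)). nra. }
assert (G : rect_int f (fun s t => 0 + RtoC s * (c t - 0))%C (fun s t => c t - 0)%C (fun s t => RtoC s * h)%C 0 1 0 1 = 0).
{ apply goursat_square with (L := 1).
  - apply (C1_square_cone 0 c (fun _ => h)), C1_path_segment.
  - lra.
  - lra.
  - intros s t Hs Ht. split; [|split].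
    + apply Hf, Hin; assumption.
    + replace (c t - 0)%C with (c t) by ring. specialize (Hc' t Ht). lra.
    + specialize (Hc s Hs). lra. }
unfold rect_int in G.
(* The side at the apex contributes 0; the other three become the two radii and the segment [c]. *)
rewrite (path_int_zero f (fun t => 0 + RtoC 0 * (c t - 0))%C) in G by (intros; ring).
rewrite (path_int_ext f (fun s => 0 + RtoC s * (c 1 - 0))%C _ (fun s => 0 + RtoC s * w)%C (fun _ => w)) in G
  by (intros; unfold c, h; f_equal; [f_equal|]; ring).
rewrite (path_int_ext f (fun s => 0 + RtoC s * (c 0 - 0))%C _ (fun s => 0 + RtoC s * z)%C (fun _ => z)) in G
  by (intros; unfold c, h; f_equal; [f_equal|]; ring).
rewrite (path_int_ext f (fun t => 0 + RtoC 1 * (c t - 0))%C _ c (fun _ => h)) in G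
  by (intros; f_equal; [f_equal|]; ring).
(* Comparison with the constant [f z]: since [be = 0], the primitive is linear and its increment is
   [f z * h]. *)
assert (N : Cmod (path_int f c (fun _ => h) 0 1 - ((f z * (c 1 - z) + 0 / 2 * ((c 1 - z) * (c 1 - z))) - (f z * (c 0 - z) + 0 / 2 * ((c 0 - z) * (c 0 - z)))))%C <= (1 - 0) * (eps * Cmod h)).
{ apply (path_int_near_affine f c (fun _ => h) 0 1 eps (Cmod h) (f z) 0 z).
  - apply C1_path_segment.
  - lra.
  - intros t Ht. apply Hf, Hc', Ht.
  - intros; lra.
  - intros t Ht. replace (f (c t) - (f z + 0 * (c t - z)))%C with (f (c t) - f z)%C by ring.
    left. apply K. unfold c. replace (z + RtoC t * h - z)%C with (RtoC t * h)%C by ring.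
    specialize (Hc t Ht). lra. }
rewrite Rminus_0_r, Rmult_1_l in N.
match type of N with Cmod ?x <= _ => match goal with |- Cmod ?y <= _ => replace y with x end end; [exact N|].
match goal with |- _ = (?X - ?Y - _)%C => replace X with (Y + path_int f c (fun _ => h) 0 1)%C end.
- unfold c, h. ring_simplify. unfold Cdiv. ring.
- match type of G with (?a + ?b - ?d - ?e)%C = _ => transitivity (a + b - e - (a + b - d - e))%C; [rewrite G|]; ring end.
Qed.

(** * Cauchy's formula on a circle *)

Lemma is_CR_derive_pair (g1 g2 : R -> R) (t d1 d2 : R) :
  is_derive g1 t d1 -> is_derive g2 t d2 ->
  @is_derive R_AbsRing C_R_NormedModule (fun u => (g1 u, g2 u)) t (d1, d2).
Proof.
intros [_ H1] [_ H2]. apply is_CR_derive_iff. intros eps He.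
assert (He2 : 0 < eps / 2) by lra.
destruct (H1 t (fun P HP => HP) (mkposreal _ He2)) as [r1 K1].
destruct (H2 t (fun P HP => HP) (mkposreal _ He2)) as [r2 K2].
exists (Rmin r1 r2). split; [apply Rmin_pos; apply cond_pos|].
intros u Hu.
assert (X1 := K1 u (Rlt_le_trans _ _ _ Hu (Rmin_l _ _))).
assert (X2 := K2 u (Rlt_le_trans _ _ _ Hu (Rmin_r _ _))).
change (Rabs (g1 u - g1 t - (u - t) * d1) <= eps / 2 * Rabs (u - t)) in X1.
change (Rabs (g2 u - g2 t - (u - t) * d2) <= eps / 2 * Rabs (u - t)) in X2.
match goal with |- Cmod ?x <= _ => replace x with
  (RtoC (g1 u - g1 t - (u - t) * d1) + Ci * RtoC (g2 u - g2 t - (u - t) * d2))%C end.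
2:{ apply injective_projections; simpl; ring. }
eapply Rle_trans; [apply Cmod_triangle|].
rewrite Cmod_mult, !Cmod_R.
replace (Cmod Ci) with 1; [lra|].
unfold Cmod, Ci; simpl. replace (0 * (0 * 1) + 1 * (1 * 1)) with 1 by ring. symmetry; apply sqrt_1.
Qed.

(** Written as a pair to unfold to the argument of [g] in [Hp_mean]. *)
Definition circle (r t : R) : C := (r * cos t, r * sin t).
Definition dcircle (r t : R) : C := (- (r * sin t), r * cos t).

Lemma C1_path_circle (r : R) : C1_path (circle r) (dcircle r).
Proof.
assert (D : forall t, @is_derive R_AbsRing C_R_NormedModule (dcircle r) t (- (r * cos t), - (r * sin t))).
{ intros t. apply is_CR_derive_pair; auto_derive; trivial; ring. }
intros t. split.
- apply is_CR_derive_pair; auto_derive; trivial; ring.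
- eapply continuous_CR_derive, D.
Qed.

Lemma Cmod_circle (r t : R) : 0 <= r -> Cmod (circle r t) = r.
Proof.
intros Hr. unfold Cmod, circle; simpl.
replace (_ + _) with (r * r * (sin t * sin t + cos t * cos t)) by ring.
fold (Rsqr (sin t)) (Rsqr (cos t)). rewrite sin2_cos2, Rmult_1_r. now apply sqrt_square.
Qed.

Lemma Cmod_dcircle (r t : R) : 0 <= r -> Cmod (dcircle r t) = r.
Proof.
intros Hr. unfold Cmod, dcircle; simpl.
replace (_ + _) with (r * r * (sin t * sin t + cos t * cos t)) by ring.
fold (Rsqr (sin t)) (Rsqr (cos t)). rewrite sin2_cos2, Rmult_1_r. now apply sqrt_square.
Qed.

(** At [z = a] the numerator vanishes and the value is 0, not the derivative; the slope is
    integrated only along curves that avoid [a]. *)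
Definition slope (f : C -> C) (a z : C) : C := ((f z - f a) / (z - a))%C.

Lemma Cminus_neq_0 (z a : C) : z <> a -> (z - a)%C <> 0.
Proof. intros H E. apply H. replace z with ((z - a) + a)%C by ring. rewrite E. ring. Qed.

(** The derivative is [(l - slope f a z) / (z - a)]. The remainder is that of [f] divided by
    [w - a], minus a term quadratic in [w - z]. *)
Lemma ex_derive_slope (f : C -> C) (a z : C) :
  @ex_derive C_AbsRing C_NormedModule f z -> z <> a ->
  @ex_derive C_AbsRing C_NormedModule (slope f a) z.
Proof.
intros [l Hl] Hza. assert (Hza0 := Cminus_neq_0 _ _ Hza).
set (N := (l - slope f a z)%C). exists (N / (z - a))%C.
apply is_C_derive_iff. intros eps He.
set (m := Cmod (z - a)). assert (Hm : 0 < m) by now apply Cmod_gt_0.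
assert (HN := Cmod_ge_0 N).
assert (He1 : 0 < eps * m / 4) by (apply Rdiv_lt_0_compat; [apply Rmult_lt_0_compat|]; lra).
destruct (proj1 (is_C_derive_iff f z l) Hl _ He1) as (d & Hd & K).
assert (He2 : 0 < eps * m * m / 4 / (1 + Cmod N)).
{ apply Rdiv_lt_0_compat; [|lra]. apply Rdiv_lt_0_compat; [|lra]. repeat apply Rmult_lt_0_compat; lra. }
(* The bound [m / 2] keeps [w] at distance at least [m / 2] from [a]; the last bound brings the
   quadratic term below [eps / 2 * Cmod (w - z)]. *)
exists (Rmin d (Rmin (m / 2) (eps * m * m / 4 / (1 + Cmod N)))).
split; [repeat apply Rmin_pos; lra|].
intros w Hw.
assert (Hw1 := Rlt_le_trans _ _ _ Hw (Rmin_l _ _)).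
assert (Hw' := Rlt_le_trans _ _ _ Hw (Rmin_r _ _)).
assert (Hw2 := Rlt_le_trans _ _ _ Hw' (Rmin_l _ _)).
assert (Hw3 := Rlt_le_trans _ _ _ Hw' (Rmin_r _ _)).
assert (Hwa : m / 2 <= Cmod (w - a)).
{ assert (T := Cmod_triangle (w - a) (-(w - z))).
  replace (w - a + - (w - z))%C with (z - a)%C in T by ring. rewrite Cmod_opp in T. fold m in T. lra. }
assert (Hwa0 : (w - a)%C <> 0) by (apply Cmod_gt_0; lra).
specialize (K w Hw1).
replace (slope f a w - slope f a z - (w - z) * (N / (z - a)))%C with
  ((f w - f z - (w - z) * l) / (w - a) + - ((w - z) * (w - z) * N / (w - a) / (z - a)))%C.
2:{ unfold N, slope. field. split; assumption. }
eapply Rle_trans; [apply Cmod_triangle|].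
rewrite Cmod_opp, !Cmod_div, !Cmod_mult by assumption. fold m.
assert (Hx := Cmod_ge_0 (w - z)). set (x := Cmod (w - z)) in *.
assert (Hinv : / Cmod (w - a) <= 2 / m).
{ replace (2 / m) with (/ (m / 2)) by (field; lra). apply Rinv_le_contravar; lra. }
assert (Hinv0 : 0 < / Cmod (w - a)) by (apply Rinv_0_lt_compat; lra).
assert (B1 : Cmod (f w - f z - (w - z) * l) / Cmod (w - a) <= eps / 2 * x).
{ replace (eps / 2 * x) with (eps * m / 4 * x * (2 / m)) by (field; lra).
  apply Rmult_le_compat; try lra. apply Cmod_ge_0. }
assert (B2 : x * x * Cmod N / Cmod (w - a) / m <= eps / 2 * x).
{ apply Rle_trans with (x * (x * (1 + Cmod N)) * (2 / m) / m).
  - apply Rmult_le_compat_r; [left; now apply Rinv_0_lt_compat|].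
    apply Rmult_le_compat; try lra; [|rewrite Rmult_assoc; apply Rmult_le_compat_l; [lra|]; apply Rmult_le_compat_l; lra].
    repeat apply Rmult_le_pos; lra.
  - assert (x * (1 + Cmod N) <= eps * m * m / 4).
    { apply (Rmult_lt_compat_r (1 + Cmod N)) in Hw3; [|lra].
      replace (eps * m * m / 4 / (1 + Cmod N) * (1 + Cmod N)) with (eps * m * m / 4) in Hw3 by (field; lra). lra. }
    replace (eps / 2 * x) with (x * (eps * m * m / 4) * (2 / m) / m) by (field; lra).
    apply Rmult_le_compat_r; [left; now apply Rinv_0_lt_compat|].
    apply Rmult_le_compat_r; [apply Rdiv_le_0_compat; lra|].
    apply Rmult_le_compat_l; lra. }
lra.
Qed.

(** The integral equals the one over the circle shrunk towards [a] by the factor [del]. There the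
    slope is at most [1 + Cmod l] and the speed at most [del], so the integral is smaller than any
    positive number. *)
Lemma cauchy_circle (f : C -> C) (a : C) (r : R) :
  analytic_D f -> Cmod a < r < 1 ->
  path_int (slope f a) (circle r) (dcircle r) 0 (2 * PI) = 0.
Proof.
intros Hf [Har Hr]. assert (Ha := Cmod_ge_0 a). assert (HPI := PI_RGT_0).
destruct (Hf a) as [l Hl]; [unfold inD; lra|].
destruct (proj1 (is_C_derive_iff f a l) Hl 1 Rlt_0_1) as (eta & Heta & K).
assert (Hl0 := Cmod_ge_0 l).
assert (Hca : forall t, r - Cmod a <= Cmod (circle r t - a) <= 2).
{ intros t. assert (Hc := Cmod_circle r t ltac:(lra)).
  assert (T := Cmod_triangle (circle r t) (- a)). assert (T' := Cmod_triangle (circle r t - a) a).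
  replace (circle r t - a + a)%C with (circle r t) in T' by ring.
  rewrite Cmod_opp in T. change (circle r t + - a)%C with (circle r t - a)%C in T. lra. }
assert (Hg : forall s t, 0 < s <= 1 ->
  @ex_derive C_AbsRing C_NormedModule (slope f a) (a + RtoC s * (circle r t - a))%C).
{ intros s t Hs. apply ex_derive_slope.
  - apply Hf. unfold inD.
    replace (a + RtoC s * (circle r t - a))%C with (RtoC (1 - s) * a + RtoC s * circle r t)%C
      by (rewrite RtoC_minus; ring).
    eapply Rle_lt_trans; [apply Cmod_triangle|].
    rewrite !Cmod_mult, !Cmod_R, !Rabs_right, Cmod_circle by lra. nra.
  - intros E. assert (Z : (RtoC s * (circle r t - a))%C = 0).
    { replace (RtoC s * (circle r t - a))%C with (a + RtoC s * (circle r t - a) - a)%C by ring. rewrite E. ring. }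
    apply (f_equal Cmod) in Z. rewrite Cmod_mult, Cmod_0, Cmod_R, Rabs_right in Z by lra.
    specialize (Hca t). assert (0 < s * Cmod (circle r t - a)) by (apply Rmult_lt_0_compat; lra). lra. }
set (I := path_int (slope f a) (circle r) (dcircle r) 0 (2 * PI)).
(* Points of the circle are within 2 of [a], so [2 * del < eta] puts the shrunk circle where the
   estimate [K] applies. *)
assert (HI : forall del, 0 < del < 1 -> 2 * del < eta -> Cmod I <= (2 * PI - 0) * ((1 + Cmod l) * del)).
{ intros del Hdel Hde.
  assert (G : rect_int (slope f a) (fun s t => a + RtoC s * (circle r t - a))%C
     (fun s t => circle r t - a)%C (fun s t => RtoC s * dcircle r t)%C del 1 0 (2 * PI) = 0).
  { apply goursat_square with (L := 2).
    - apply C1_square_cone, C1_path_circle.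
    - lra.
    - lra.
    - intros s t Hs _. split; [|split].
      + apply Hg; lra.
      + apply Hca.
      + rewrite Cmod_mult, Cmod_R, Cmod_dcircle, Rabs_right by lra. nra. }
  unfold rect_int in G.
  (* The sides [t = 0] and [t = 2 * PI] are the same segment, traversed in opposite directions, and
     cancel. *)
  assert (P : circle r (2 * PI) = circle r 0).
  { unfold circle. now rewrite cos_2PI, sin_2PI, cos_0, sin_0. }
  rewrite P in G.
  rewrite (path_int_ext _ (fun t => a + RtoC 1 * (circle r t - a))%C _ (circle r) (dcircle r)) in G
    by (intros; f_equal; [f_equal|]; ring).
  fold I in G.
  match type of G with (?x + ?y - ?x - ?z)%C = _ => assert (E : I = z) end.
  { match type of G with (?x + ?y - ?x - ?z)%C = _ => transitivity ((x + y - x - z) + z)%C; [ring|rewrite G; ring] end. }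
  rewrite E.
  (* The subtracted increment is 0, written in the shape of [path_int_near_affine] with
     [al = be = z0 = 0]; that lemma then bounds the integral itself. *)
  match goal with |- Cmod ?x <= _ => replace x with (x - ((0 * (a + RtoC del * (circle r (2 * PI) - a) - 0)
     + 0 / 2 * ((a + RtoC del * (circle r (2 * PI) - a) - 0) * (a + RtoC del * (circle r (2 * PI) - a) - 0)))
     - (0 * (a + RtoC del * (circle r 0 - a) - 0)
     + 0 / 2 * ((a + RtoC del * (circle r 0 - a) - 0) * (a + RtoC del * (circle r 0 - a) - 0)))))%C end.
  2:{ unfold Cdiv. ring. }
  apply (path_int_near_affine (slope f a) (fun t => a + RtoC del * (circle r t - a))%C _ 0 (2 * PI) (1 + Cmod l) del 0 0 0).
  - apply (C1_square_cone a (circle r) (dcircle r) (C1_path_circle r)).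
  - lra.
  - intros t _. apply Hg; lra.
  - intros t _. rewrite Cmod_mult, Cmod_R, Cmod_dcircle, Rabs_right by lra. nra.
  - intros t _. set (w := (a + RtoC del * (circle r t - a))%C).
    assert (Ew : Cmod (w - a) = del * Cmod (circle r t - a)).
    { unfold w. replace (a + RtoC del * (circle r t - a) - a)%C with (RtoC del * (circle r t - a))%C by ring.
      rewrite Cmod_mult, Cmod_R, Rabs_right; lra. }
    specialize (Hca t).
    assert (Hw1 : 0 < Cmod (w - a)) by (rewrite Ew; apply Rmult_lt_0_compat; lra).
    assert (Hw0 : (w - a)%C <> 0) by now apply Cmod_gt_0.
    replace (slope f a w - (0 + 0 * (w - 0)))%C with (slope f a w) by ring.
    unfold slope. rewrite Cmod_div by exact Hw0.
    assert (Kw : Cmod (f w - f a - (w - a) * l) <= 1 * Cmod (w - a)) by (apply K; rewrite Ew; nra).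
    assert (T := Cmod_triangle (f w - f a - (w - a) * l) ((w - a) * l)).
    replace (f w - f a - (w - a) * l + (w - a) * l)%C with (f w - f a)%C in T by ring.
    rewrite Cmod_mult in T.
    apply (Rmult_le_reg_r (Cmod (w - a))); [exact Hw1|].
    unfold Rdiv. rewrite Rmult_assoc, Rinv_l by lra. lra. }
apply Cmod_eq_0. apply Rle_antisym; [|apply Cmod_ge_0].
apply Rnot_lt_le. intros Hpos.
set (M := 2 * PI * (1 + Cmod l)). assert (HM : 0 < M) by (apply Rmult_lt_0_compat; lra).
(* The first two bounds meet the premises of [HI]; the third turns its conclusion into
   [Cmod I <= Cmod I / 2]. *)
set (del := Rmin (1 / 2) (Rmin (eta / 4) (Cmod I / (2 * M)))).
assert (D1 : del <= 1 / 2) by apply Rmin_l.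
assert (D2 : del <= eta / 4) by (eapply Rle_trans; [apply Rmin_r|apply Rmin_l]).
assert (D3 : del <= Cmod I / (2 * M)) by (eapply Rle_trans; [apply Rmin_r|apply Rmin_r]).
assert (D0 : 0 < del).
{ repeat apply Rmin_pos; try lra. apply Rdiv_lt_0_compat; lra. }
specialize (HI del ltac:(lra) ltac:(lra)).
apply (Rmult_le_compat_l M) in D3; [|lra].
replace (M * (Cmod I / (2 * M))) with (Cmod I / 2) in D3 by (field; lra).
unfold M in D3. lra.
Qed.

(** * Point evaluation on the Hardy space *)

Lemma powp_ge_0 (x p : R) : 0 <= powp x p.
Proof. unfold powp. destruct (Rle_dec x 0); [lra|left; apply exp_pos]. Qed.

Lemma continuous_powp (p x : R) : 0 < p -> continuous (fun y => powp y p) x.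
Proof.
intros Hp. destruct (Rtotal_order x 0) as [Hx | [-> | Hx]].
- apply continuous_ext_loc with (fun _ => 0); [|apply continuous_const].
  apply (locally_interval _ x m_infty 0); [exact Logic.I|exact Hx|].
  intros y _ Hy. simpl in Hy. unfold powp. destruct (Rle_dec y 0); [reflexivity|lra].
- apply continuity_pt_filterlim. intros eps He.
  (* The solution of [y^p = eps], as the power is increasing on the positive axis. *)
  exists (Rpower eps (/ p)). split; [apply exp_pos|].
  intros y [_ Hy]. simpl in *. unfold Rdist in *. rewrite Rminus_0_r in Hy.
  unfold powp. destruct (Rle_dec 0 0) as [_|]; [|lra]. rewrite Rminus_0_r.
  destruct (Rle_dec y 0) as [Hy0|Hy0].
  + rewrite Rabs_R0. exact He.
  + rewrite Rabs_right by (left; apply exp_pos). rewrite Rabs_right in Hy by lra.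
    replace eps with (Rpower (Rpower eps (/ p)) p).
    * apply Rlt_Rpower_l; lra.
    * rewrite Rpower_mult, Rinv_l, Rpower_1; lra.
- apply continuous_ext_loc with (fun y => Rpower y p).
  + apply (locally_interval _ x 0 p_infty); [exact Hx|exact Logic.I|].
    intros y Hy _. simpl in Hy. unfold powp. destruct (Rle_dec y 0); [lra|reflexivity].
  + apply (ex_derive_continuous (V := R_NormedModule)).
    unfold Rpower. auto_derive. exact Hx.
Qed.

(** Beyond [lam], write [x = x^(1-p) * x^p] and use that [x^(1-p)] decreases. This linear bound
    takes the place of Hölder's inequality. *)
Lemma le_weighted_powp (p x lam : R) : 1 < p -> 0 <= x -> 0 < lam ->
  x <= lam + Rpower lam (1 - p) * powp x p.
Proof.
intros Hp Hx Hl. assert (H1 : 0 < Rpower lam (1 - p)) by apply exp_pos.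
destruct (Rle_dec x lam) as [H|H].
- assert (H2 := powp_ge_0 x p). nra.
- unfold powp. destruct (Rle_dec x 0); [lra|].
  assert (E : x = Rpower x (1 - p) * Rpower x p).
  { rewrite <- Rpower_plus. replace (1 - p + p) with 1 by ring. rewrite Rpower_1; lra. }
  assert (M : Rpower x (1 - p) <= Rpower lam (1 - p)).
  { replace (1 - p) with (- (p - 1)) by ring. rewrite !Rpower_Ropp.
    apply Rinv_le_contravar; [apply exp_pos|]. apply Rle_Rpower_l; lra. }
  rewrite E at 1. assert (H3 : 0 < Rpower x p) by apply exp_pos. nra.
Qed.

(** After multiplication by [2 * |c - a|^2] the claim reads [|c - a|^2 <= 2 Re (c conj (c - a))],
    that is [|a|^2 <= |c|^2]. *)
Lemma Re_circle_kernel (a c : C) : Cmod a < Cmod c -> 1 / 2 <= fst (c / (c - a))%C.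
Proof.
intros H. destruct a as [u v], c as [x y].
assert (H2 : u * u + v * v < x * x + y * y).
{ unfold Cmod in H; simpl in H. rewrite !Rmult_1_r in H. now apply sqrt_lt_0_alt. }
unfold Cdiv, Cinv, Cmult, Cminus, Cplus, Copp; simpl.
set (D := (x + - u) * ((x + - u) * 1) + (y + - v) * ((y + - v) * 1)).
assert (HD : 0 < D).
{ unfold D. destruct (Req_dec x u) as [-> |Hx]; [destruct (Req_dec y v) as [-> |Hy]|]; [lra| |].
  - assert (0 < (y - v) * (y - v)) by (apply Rsqr_pos_lt; lra). lra.
  - assert (0 < (x - u) * (x - u)) by (apply Rsqr_pos_lt; lra).
    assert (0 <= (y - v) * (y - v)) by apply Rle_0_sqr. lra. }
apply (Rmult_le_reg_r D); [exact HD|].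
replace ((x * ((x + - u) / D) - y * (- (y + - v) / D)) * D) with (x * (x - u) + y * (y - v)) by (field; lra).
unfold D. lra.
Qed.

Lemma exists_rotation (z : C) : exists w : C, Cmod w = 1 /\ (w * z)%C = RtoC (Cmod z).
Proof.
destruct (Ceq_dec z 0) as [-> |Hz].
- exists 1. rewrite Cmod_1, Cmod_0. split; [reflexivity|ring].
- assert (Hm := proj1 (Cmod_gt_0 z) Hz).
  assert (Hm0 : RtoC (Cmod z) <> 0) by (intros E; apply RtoC_inj in E; lra).
  exists (RtoC (Cmod z) / z)%C. split.
  + rewrite Cmod_div by exact Hz. rewrite Cmod_R, Rabs_right by lra. field. lra.
  + field. exact Hz.
Qed.

Lemma analytic_D_scal (w : C) (f : C -> C) : analytic_D f -> analytic_D (fun z => w * f z)%C.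
Proof.
intros Hf z Hz. destruct (Hf z Hz) as [l Hl]. exists (w * l)%C.
apply is_C_derive_iff. intros eps He. assert (Hw := Cmod_ge_0 w).
destruct (proj1 (is_C_derive_iff f z l) Hl (eps / (1 + Cmod w))) as (d & Hd & K).
{ apply Rdiv_lt_0_compat; lra. }
exists d. split; [exact Hd|]. intros v Hv. specialize (K v Hv).
replace (w * f v - w * f z - (v - z) * (w * l))%C with (w * (f v - f z - (v - z) * l))%C by ring.
rewrite Cmod_mult.
assert (H := Cmod_ge_0 (f v - f z - (v - z) * l)).
apply Rle_trans with ((1 + Cmod w) * (eps / (1 + Cmod w) * Cmod (v - z))).
- apply Rmult_le_compat; lra.
- right. field. lra.
Qed.

Lemma fst_le_Cmod (z : C) : fst z <= Cmod z.
Proof. eapply Rle_trans; [apply Rle_abs|]. eapply Rle_trans; [apply Rmax_l|apply Rmax_Cmod]. Qed.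

Lemma continuous_Cmod (g : R -> C) (t : R) :
  @continuous R_UniformSpace C_UniformSpace g t -> continuous (fun u => Cmod (g u)) t.
Proof.
intros Hg. apply (continuous_comp g Cmod); [exact Hg|].
apply continuous_ext with (f := @norm R_AbsRing C_R_NormedModule); [intros x; symmetry; apply Cmod_norm|].
apply (filterlim_norm (K := R_AbsRing) (V := C_R_NormedModule)).
Qed.

(** With [k = z / (z - a)], Cauchy's formula equates the means of [Re (F k)] and [|f a| Re k]. The
    former is at most [kap] times the mean of [|f|], the latter at least [|f a| / 2], whence the
    factor 2. *)
Lemma point_eval_le_Hp_mean (p : R) (f : C -> C) (a : C) (r lam : R) :
  1 < p -> analytic_D f -> Cmod a < r < 1 -> 0 < lam ->
  Cmod (f a) <= 2 * (r / (r - Cmod a)) * (lam + Rpower lam (1 - p) * Hp_mean p f r).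
Proof.
intros Hp Hf Har Hlam. assert (Ha := Cmod_ge_0 a). assert (HPI := PI_RGT_0).
(* After a rotation the value at [a] is real, so that the real part of the
   Cauchy integral bounds it. *)
destruct (exists_rotation (f a)) as (w & Hw & Hwa).
set (F := fun z => (w * f z)%C).
assert (HF : analytic_D F) by now apply analytic_D_scal.
set (kap := r / (r - Cmod a)).
assert (Hkap : 0 < kap) by (apply Rdiv_lt_0_compat; lra).
assert (Hc : forall t, Cmod (circle r t) = r) by (intros; apply Cmod_circle; lra).
assert (Hin : forall t, inD (circle r t)) by (intros t; unfold inD; rewrite Hc; lra).
assert (Hca : forall t, r - Cmod a <= Cmod (circle r t - a)).
{ intros t. assert (T := Cmod_triangle (circle r t - a) a).
  replace (circle r t - a + a)%C with (circle r t) in T by ring. rewrite Hc in T. lra. }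
assert (Hne : forall t, circle r t <> a).
{ intros t E. assert (X := Hc t). rewrite E in X. lra. }
assert (I1 : @is_RInt C_R_NormedModule (fun t => slope F a (circle r t) * dcircle r t)%C 0 (2 * PI) (0 : C)).
{ rewrite <- (cauchy_circle F a r HF Har).
  apply (RInt_correct (V := C_R_CompleteNormedModule)).
  apply ex_path_int; [apply C1_path_circle|lra|].
  intros t _. apply ex_derive_slope; [apply HF, Hin|apply Hne]. }
assert (I2 : is_RInt (fun t => snd (slope F a (circle r t) * dcircle r t)%C) 0 (2 * PI) 0)
  by exact (is_RInt_fct_extend_snd (U := R_NormedModule) (V := R_NormedModule) _ _ _ _ I1).
set (q := fun t => powp (Cmod (f (circle r t))) p).
assert (Iq : is_RInt q 0 (2 * PI) (2 * PI * Hp_mean p f r)).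
{ assert (E : @eq R (2 * PI * Hp_mean p f r) (RInt q 0 (2 * PI))) by (unfold Hp_mean, q, circle; field; lra).
  rewrite E.
  apply (RInt_correct (V := R_CompleteNormedModule)), (ex_RInt_continuous (V := R_CompleteNormedModule)).
  intros t _. apply (continuous_comp (fun t => Cmod (f (circle r t))) (fun y => powp y p)); [|apply continuous_powp; lra].
  apply continuous_Cmod. destruct (Hf _ (Hin t)) as [l Hl].
  eapply continuous_CR_derive, is_derive_C_comp_path; [exact Hl|apply C1_path_circle]. }
assert (I3 : is_RInt (fun t => kap * (lam + Rpower lam (1 - p) * q t) - Cmod (f a) / 2) 0 (2 * PI)
   (kap * ((2 * PI - 0) * lam + Rpower lam (1 - p) * (2 * PI * Hp_mean p f r)) - (2 * PI - 0) * (Cmod (f a) / 2))).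
{ apply (is_RInt_minus (V := R_NormedModule)); [|apply (is_RInt_const (V := R_NormedModule))].
  apply (is_RInt_scal (V := R_NormedModule)).
  apply (is_RInt_plus (V := R_NormedModule)); [apply (is_RInt_const (V := R_NormedModule))|].
  now apply (is_RInt_scal (V := R_NormedModule)). }
(* The imaginary part of the Cauchy integrand has integral 0 and is dominated pointwise by the
   integrand of [I3]. *)
assert (L : 0 <= kap * ((2 * PI - 0) * lam + Rpower lam (1 - p) * (2 * PI * Hp_mean p f r)) - (2 * PI - 0) * (Cmod (f a) / 2)).
{ apply (is_RInt_le _ _ 0 (2 * PI) _ _ ltac:(lra) I2 I3).
  intros t _.
  assert (Hca0 : (circle r t - a)%C <> 0) by apply Cminus_neq_0, Hne.
  set (k := (circle r t / (circle r t - a))%C).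
  (* On the circle [dz = i z dt], and the factor [i] turns the imaginary part into the real part of
     what it multiplies. *)
  assert (E : (slope F a (circle r t) * dcircle r t = Ci * (F (circle r t) * k - RtoC (Cmod (f a)) * k))%C).
  { replace (dcircle r t) with (Ci * circle r t)%C by (apply injective_projections; simpl; ring).
    rewrite <- Hwa. unfold slope, k, F. field. exact Hca0. }
  rewrite E.
  replace (snd (Ci * (F (circle r t) * k - RtoC (Cmod (f a)) * k))%C) with (fst (F (circle r t) * k)%C - Cmod (f a) * fst k)
    by (simpl; ring).
  assert (X1 : 1 / 2 <= fst k) by (apply Re_circle_kernel; rewrite Hc; lra).
  assert (X2 := fst_le_Cmod (F (circle r t) * k)%C).
  assert (X3 : Cmod k <= kap).
  { unfold k, kap. rewrite Cmod_div, Hc by exact Hca0. apply Rmult_le_compat_l; [lra|].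
    apply Rinv_le_contravar; [lra|apply Hca]. }
  assert (X4 : Cmod (F (circle r t)) = Cmod (f (circle r t))) by (unfold F; rewrite Cmod_mult, Hw; ring).
  rewrite Cmod_mult, X4 in X2.
  assert (X5 := le_weighted_powp p (Cmod (f (circle r t))) lam Hp (Cmod_ge_0 _) Hlam).
  fold (q t) in X5.
  assert (X6 := Cmod_ge_0 (f a)). assert (X7 := Cmod_ge_0 (f (circle r t))).
  nra. }
apply (Rmult_le_reg_l PI); [lra|]. lra.
Qed.

(** Taking for [lam] the norm [S^(1/p)] makes the two terms equal, as [lam^(1-p) * S = lam]; hence
    the constant [4 * kap], with [r] halfway between [Cmod a] and 1. *)
Lemma point_eval_bounded (p : R) (a : C) : 1 < p -> inD a ->
  exists K, forall f, in_Hp p f -> Cmod (f a) <= K * Hp_norm p f.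
Proof.
intros Hp Ha. unfold inD in Ha. assert (Ha0 := Cmod_ge_0 a).
set (r := (1 + Cmod a) / 2). assert (Hr : Cmod a < r < 1) by (unfold r; lra).
set (kap := r / (r - Cmod a)). assert (Hkap : 0 < kap) by (apply Rdiv_lt_0_compat; lra).
exists (4 * kap). intros f [Hf Hfin].
unfold Hp_norm. set (S := real (Hp_sup p f)).
assert (HS : Hp_mean p f r <= S).
{ destruct (Lub_Rbar_correct (fun x : R => exists r : R, 0 < r < 1 /\ x = Hp_mean p f r)) as [U _].
  fold (Hp_sup p f) in U. rewrite <- Hfin in U. apply (U (Hp_mean p f r)).
  exists r. split; [lra|reflexivity]. }
assert (B : forall lam, 0 < lam -> Cmod (f a) <= 2 * kap * (lam + Rpower lam (1 - p) * S)).
{ intros lam Hlam. eapply Rle_trans; [apply point_eval_le_Hp_mean; eassumption|].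
  apply Rmult_le_compat_l; [fold kap; lra|]. apply Rplus_le_compat_l.
  apply Rmult_le_compat_l; [left; apply exp_pos|exact HS]. }
unfold powp. destruct (Rle_dec S 0) as [HS0|HS0].
(* Here the norm is 0, so [f a] has to vanish: otherwise this [lam] bounds [Cmod (f a)] by its
   half. *)
- rewrite Rmult_0_r. apply Rnot_lt_le. intros Hpos.
  specialize (B (Cmod (f a) / (4 * kap)) ltac:(apply Rdiv_lt_0_compat; lra)).
  assert (0 < Rpower (Cmod (f a) / (4 * kap)) (1 - p)) by apply exp_pos.
  assert (E : 2 * kap * (Cmod (f a) / (4 * kap)) = Cmod (f a) / 2) by (field; lra).
  assert (Rpower (Cmod (f a) / (4 * kap)) (1 - p) * S <= 0) by nra.
  nra.
- specialize (B (Rpower S (1 / p)) ltac:(apply exp_pos)).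
  rewrite Rpower_mult in B. rewrite <- (Rpower_1 S) in B at 3 by lra.
  rewrite <- Rpower_plus in B.
  replace (1 / p * (1 - p) + 1) with (1 / p) in B by (field; lra). lra.
Qed.

(** * The operators *)

Lemma cderiv_unique (f : C -> C) (z l : C) :
  @is_derive C_AbsRing C_NormedModule f z l -> cderiv f z = l.
Proof.
intros H. rewrite <- (is_C_derive_unique f z l H). symmetry. apply is_C_derive_unique.
unfold cderiv. apply epsilon_spec. now exists l.
Qed.

(** The disk is open, so [w] near [z] stays in it. Functions are total but determined only on the
    disk, and the following lemmas make spaces and norms insensitive to the values outside. *)
Lemma is_derive_ext_D (f g : C -> C) (z l : C) :
  (forall w, inD w -> f w = g w) -> inD z ->
  @is_derive C_AbsRing C_NormedModule f z l -> @is_derive C_AbsRing C_NormedModule g z l.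
Proof.
intros E Hz H. apply is_C_derive_iff. intros eps He. unfold inD in Hz.
destruct (proj1 (is_C_derive_iff f z l) H eps He) as (d & Hd & K).
exists (Rmin d (1 - Cmod z)). split; [apply Rmin_pos; lra|].
intros w Hw. rewrite <- !E; [|exact Hz|].
- apply K. eapply Rlt_le_trans; [exact Hw|apply Rmin_l].
- unfold inD. assert (Hw2 := Rlt_le_trans _ _ _ Hw (Rmin_r _ _)).
  assert (T := Cmod_triangle (w - z) z). replace (w - z + z)%C with w in T by ring. lra.
Qed.

Lemma analytic_D_ext (f g : C -> C) :
  (forall w, inD w -> f w = g w) -> analytic_D f -> analytic_D g.
Proof.
intros E Hf z Hz. destruct (Hf z Hz) as [l Hl]. exists l. now apply is_derive_ext_D with f.
Qed.

Lemma cderiv_ext_D (f g : C -> C) :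
  (forall w, inD w -> f w = g w) -> analytic_D f ->
  forall z, inD z -> cderiv f z = cderiv g z.
Proof.
intros E Hf z Hz. destruct (Hf z Hz) as [l Hl].
rewrite (cderiv_unique f z l Hl). symmetry. apply cderiv_unique.
now apply is_derive_ext_D with f.
Qed.

Lemma Hp_sup_ext (p : R) (f g : C -> C) :
  (forall w, inD w -> f w = g w) -> Hp_sup p f = Hp_sup p g.
Proof.
intros E. apply Lub_Rbar_eqset. intros x.
assert (M : forall r, 0 < r < 1 -> Hp_mean p f r = Hp_mean p g r).
{ intros r Hr. unfold Hp_mean. f_equal. apply RInt_ext. intros t _.
  do 2 f_equal. apply E. unfold inD. fold (circle r t). rewrite Cmod_circle; lra. }
split; intros (r & Hr & ->); exists r; split; try assumption; [|symmetry]; now apply M.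
Qed.

Lemma in_Hp_ext (p : R) (f g : C -> C) :
  (forall w, inD w -> f w = g w) -> in_Hp p f -> in_Hp p g.
Proof.
intros E [H1 H2]. split; [now apply analytic_D_ext with f|]. now rewrite <- (Hp_sup_ext p f g E).
Qed.

Lemma Hp_norm_ext (p : R) (f g : C -> C) :
  (forall w, inD w -> f w = g w) -> Hp_norm p f = Hp_norm p g.
Proof. intros E. unfold Hp_norm. now rewrite (Hp_sup_ext p f g E). Qed.

Lemma inD_0 : inD 0.
Proof. unfold inD. rewrite Cmod_0. lra. Qed.

Lemma in_Sp_ext (p : R) (f g : C -> C) :
  (forall w, inD w -> f w = g w) -> in_Sp p f -> in_Sp p g.
Proof.
intros E [H1 H2]. split; [now apply analytic_D_ext with f|].
apply in_Hp_ext with (2 := H2). now apply cderiv_ext_D.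
Qed.

Lemma Sp_norm_ext (p : R) (f g : C -> C) :
  (forall w, inD w -> f w = g w) -> analytic_D f -> Sp_norm p f = Sp_norm p g.
Proof.
intros E Hf. unfold Sp_norm. rewrite (E 0 inD_0). f_equal.
apply Hp_norm_ext. now apply cderiv_ext_D.
Qed.

Lemma analytic_D_comp (phi f : C -> C) :
  self_map_D phi -> analytic_D f -> analytic_D (Comp phi f).
Proof.
intros [Hphi Hself] Hf z Hz. destruct (Hphi z Hz) as [m [_ Hm]].
destruct (Hf _ (Hself z Hz)) as [l Hl]. exists (scal m l).
apply (is_derive_comp (K := C_AbsRing) (V := C_NormedModule) f phi); [exact Hl|].
split; [apply is_linear_scal_l|exact Hm].
Qed.

Lemma Hp_norm_ge_0 (p : R) (f : C -> C) : 0 <= Hp_norm p f.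
Proof. apply powp_ge_0. Qed.

(** * The four implications *)

Lemma Dphi_bounded_Comp_bounded (p : R) (phi : C -> C) :
  self_map_D phi ->
  bounded_op (in_Sp p) (Sp_norm p) (in_Sp p) (Sp_norm p) (Dphi phi) ->
  bounded_op (in_Hp p) (Hp_norm p) (in_Sp p) (Sp_norm p) (Comp phi).
Proof.
intros [_ Hself] [HT [K HK]].
(* [cderiv F] equals [f] on the disk only, so membership and norms are carried over by the
   extensionality lemmas. *)
assert (P : forall f, in_Hp p f -> exists F, in_Sp p F /\ Sp_norm p F = Hp_norm p f /\
  forall z, inD z -> Dphi phi F z = Comp phi f z).
{ intros f Hf. destruct (analytic_D_primitive f (proj1 Hf)) as (F & HF0 & HF).
  assert (E : forall z, inD z -> cderiv F z = f z) by (intros z Hz; now apply cderiv_unique, HF).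
  exists F. split; [|split].
  - split; [intros z Hz; exists (f z); now apply HF|].
    apply in_Hp_ext with (2 := Hf). intros z Hz. now rewrite E.
  - unfold Sp_norm. rewrite HF0, Cmod_0, (Hp_norm_ext p _ f E). ring.
  - intros z Hz. apply E, Hself, Hz. }
split; [|exists K]; intros f Hf; destruct (P f Hf) as (F & HF & HN & E).
- apply in_Sp_ext with (1 := E), HT, HF.
- rewrite <- (Sp_norm_ext p _ _ E (proj1 (HT F HF))), <- HN. now apply HK.
Qed.

Lemma Comp_bounded_Dphi_bounded (p : R) (phi : C -> C) :
  bounded_op (in_Hp p) (Hp_norm p) (in_Sp p) (Sp_norm p) (Comp phi) ->
  bounded_op (in_Sp p) (Sp_norm p) (in_Sp p) (Sp_norm p) (Dphi phi).
Proof.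
(* [Dphi phi f] is [Comp phi (cderiv f)] by conversion. The bound uses [Rmax K 0] since the
   [S^p]-norm adds [K * Cmod (f 0)] and [K] may be negative. *)
intros [HT [K HK]]. split; [|exists (Rmax K 0)]; intros f [_ Hf].
- exact (HT _ Hf).
- eapply Rle_trans; [exact (HK _ Hf)|]. unfold Sp_norm.
  assert (H1 := Hp_norm_ge_0 p (cderiv f)). assert (H2 := Cmod_ge_0 (f 0)).
  assert (H3 := Rmax_l K 0). assert (H4 := Rmax_r K 0). nra.
Qed.

Lemma Comp_bounded_DComp_bounded (p : R) (phi : C -> C) :
  bounded_op (in_Hp p) (Hp_norm p) (in_Sp p) (Sp_norm p) (Comp phi) ->
  bounded_op (in_Hp p) (Hp_norm p) (in_Hp p) (Hp_norm p) (DComp phi).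
Proof.
intros [HT [K HK]]. split; [|exists K]; intros f Hf.
- exact (proj2 (HT f Hf)).
- eapply Rle_trans; [|exact (HK f Hf)]. unfold Sp_norm.
  change (cderiv (Comp phi f)) with (DComp phi f).
  assert (H := Cmod_ge_0 (Comp phi f 0)). lra.
Qed.

Lemma DComp_bounded_Comp_bounded (p : R) (phi : C -> C) :
  1 < p -> self_map_D phi ->
  bounded_op (in_Hp p) (Hp_norm p) (in_Hp p) (Hp_norm p) (DComp phi) ->
  bounded_op (in_Hp p) (Hp_norm p) (in_Sp p) (Sp_norm p) (Comp phi).
Proof.
intros Hp Hphi [HT [K HK]].
destruct (point_eval_bounded p (phi 0) Hp (proj2 Hphi 0 inD_0)) as [K' HK'].
(* [K'] bounds the value at [phi 0], which is the first summand of the [S^p]-norm, and [K] bounds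
   the second. *)
split; [|exists (K' + K)]; intros f Hf.
- split; [exact (analytic_D_comp phi f Hphi (proj1 Hf))|exact (HT f Hf)].
- rewrite Rmult_plus_distr_r. exact (Rplus_le_compat _ _ _ _ (HK' f Hf) (HK f Hf)).
Qed.

Theorem theorem3p2 (p : R) (phi : C -> C) :
  1 < p -> self_map_D phi -> in_Sp p phi ->
  (bounded_op (in_Sp p) (Sp_norm p) (in_Sp p) (Sp_norm p) (Dphi phi) <->
   bounded_op (in_Hp p) (Hp_norm p) (in_Sp p) (Sp_norm p) (Comp phi)) /\
  (bounded_op (in_Hp p) (Hp_norm p) (in_Sp p) (Sp_norm p) (Comp phi) <->
   bounded_op (in_Hp p) (Hp_norm p) (in_Hp p) (Hp_norm p) (DComp phi)).
Proof.
intros Hp Hphi _. split; split.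
- now apply Dphi_bounded_Comp_bounded.
- apply Comp_bounded_Dphi_bounded.
- apply Comp_bounded_DComp_bounded.
- now apply DComp_bounded_Comp_bounded.
Qed.
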